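(* Let $T$ be an automorphism of a standard probability Borel space $(X,\mathcal{B},\mu)$, $G$ a second countable locally compact Abelian group, $\varphi:X\to G$ a measurable map, $\mathcal{S}=(S_g)_{g\in G}$ a $G$-action on a standard probability Borel space $(Y,\mathcal{C},\nu)$, and $T_{\varphi,\mathcal{S}}(x,y)=(Tx,S_{\varphi(x)}(y))$ on $(X\times Y,\mathcal{B}\otimes\mathcal{C},\mu\otimes\nu)$. If $T$ is ergodic and $T_{\varphi,\mathcal{S}}$ is not ergodic, then there is a non-trivial factor $\mathcal{A}\subset\mathcal{C}$ of $\mathcal{S}$ such that $T_{\varphi,\mathcal{S}}|_{\mathcal{B}\otimes\mathcal{A}}$ is relatively isomorphic to $(T\times \mathrm{id}_Y)|_{\mathcal{B}\otimes\mathcal{A}}$.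
   Context: An automorphism is an invertible measure-preserving transformation. A $G$-action is a measurable group homomorphism $g\mapsto S_g\in\mathrm{Aut}(Y,\mathcal{C},\nu)$. A factor of $\mathcal{S}$ is an $\mathcal{S}$-invariant sub-$\sigma$-algebra $\mathcal{A}\subset\mathcal{C}$ (mod $\nu$); it is non-trivial if it contains a set of measure strictly between $0$ and $1$. The restriction to an invariant sub-$\sigma$-algebra denotes the induced automorphism on the corresponding quotient space; so $T_{\varphi,\mathcal{S}}|_{\mathcal{B}\otimes\mathcal{A}}$ acts on $X\times Y/\mathcal{A}$ by $(x,\bar y)\mapsto(Tx,S_{\varphi(x)}|_{\mathcal{A}}(\bar y))$. ''Relatively isomorphic'' means isomorphic via an isomorphism which is the identity on the factor $X$, i.e. of the form $(x,\bar y)\mapsto(x,R_x(\bar y))$ with $x\mapsto R_x\in\mathrm{Aut}(Y/\mathcal{A},\mathcal{A},\nu|_{\mathcal{A}})$ measurable. *)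

(* Defs.v *)
From HB Require Import structures.
From mathcomp Require Import all_boot all_order all_algebra.
From mathcomp Require Import all_classical all_reals all_analysis.
From mathcomp Require Import measurable_realfun.

Set Implicit Arguments.
Unset Strict Implicit.
Unset Printing Implicit Defensive.

Import Order.TTheory GRing.Theory Num.Theory.
Local Open Scope classical_set_scope.
Local Open Scope ring_scope.
Local Open Scope ereal_scope.

(* Throughout, point maps and sigma-algebras are taken modulo null sets: an
   element of Aut(Y, nu) is given by a map representing its class. *)

(* [G] with its Borel sigma-algebra; [g_sigma_algebraType (@open G)] only has
   its measurable structure over a [pointedType]. *)
Definition borelType (G : topologicalZmodType) : Type := G.

HB.instance Definition _ (G : topologicalZmodType) :=
  gen_eqMixin (borelType G).
HB.instance Definition _ (G : topologicalZmodType) :=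
  gen_choiceMixin (borelType G).
HB.instance Definition _ (G : topologicalZmodType) :=
  isPointed.Build (borelType G) (0%R : G).
HB.instance Definition _ (G : topologicalZmodType) :=
  @isMeasurable.Build (sigma_display (@open G)) (borelType G)
    <<s (@open G) >> (@sigma_algebra0 _ setT (@open G))
    (@sigma_algebraC (borelType G) (@open G))
    (@sigma_algebra_bigcup _ setT (@open G)).

(* Isomorphic, as a measurable space, to a Polish space with its Borel sets. *)
Definition standard_borel (R : realType) (d : measure_display)
    (T : measurableType d) : Prop :=
  exists (P : metricType R) (f : T -> P),
    [/\ forall F : set_system P, ProperFilter F -> cauchy F ->
          exists l : P, F --> l,
        exists2 D : set P, countable D & dense D,
        bijective f &
        forall A : set T, measurable A <-> <<s (@open P) >> (f @` A)].

Definition eq_mod0 (R : realType) (d : measure_display) (T : measurableType d)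
    (mu : {measure set T -> \bar R}) (A B : set T) : Prop :=
  mu (A `+` B) = 0.

Definition automorphism (R : realType) (d : measure_display)
    (T : measurableType d) (mu : {measure set T -> \bar R}) (f : T -> T) :
    Prop :=
  [/\ measurable_fun setT f,
      forall A, measurable A -> mu (f @^-1` A) = mu A &
      exists g : T -> T,
        [/\ measurable_fun setT g,
            {ae mu, forall x, g (f x) = x} &
            {ae mu, forall x, f (g x) = x}]].

Definition ergodic (R : realType) (d : measure_display) (T : measurableType d)
    (mu : {measure set T -> \bar R}) (f : T -> T) : Prop :=
  forall A, measurable A -> eq_mod0 mu (f @^-1` A) A -> mu A = 0 \/ mu A = 1.

(* Measurability of x |-> U x as a map into Aut(Y, nu), whose Borel structure
   (for the weak topology) is generated by the maps V |-> nu (V^-1 A & B). *)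
Definition measurable_into_Aut (R : realType) (d d' : measure_display)
    (X : measurableType d) (Y : measurableType d')
    (nu : {measure set Y -> \bar R}) (U : X -> Y -> Y) : Prop :=
  (forall x, automorphism nu (U x)) /\
  forall A B, measurable A -> measurable B ->
    measurable_fun setT (fun x => nu (U x @^-1` A `&` B)).

Definition is_action (R : realType) (G : topologicalZmodType)
    (d : measure_display) (Y : measurableType d)
    (nu : {measure set Y -> \bar R}) (S : G -> Y -> Y) : Prop :=
  measurable_into_Aut nu (S : borelType G -> Y -> Y) /\
  forall g h : G, {ae nu, forall y, S (g + h)%R y = S g (S h y)}.

(* [F] is the measurable transformation (x, y) |-> (T x, U x y) of the product.
   As each U x is only given up to a null set, the formula is required for
   almost every y, for almost every x; by Fubini this determines the class
   of [F], whichever representatives U x are used. *)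
Definition is_skew_product (R : realType) (d d' : measure_display)
    (X : measurableType d) (Y : measurableType d')
    (mu : {measure set X -> \bar R}) (nu : {measure set Y -> \bar R})
    (T : X -> X) (U : X -> Y -> Y) (F : X * Y -> X * Y) : Prop :=
  measurable_fun setT F /\
  {ae mu, forall x, {ae nu, forall y, F (x, y) = (T x, U x y)}}.

Definition is_factor (R : realType) (G : Type) (d : measure_display)
    (Y : measurableType d) (nu : {measure set Y -> \bar R})
    (S : G -> Y -> Y) (A : set (set Y)) : Prop :=
  [/\ sigma_algebra setT A,
      A `<=` measurable &
      forall g a, A a -> exists2 b, A b & eq_mod0 nu (S g @^-1` a) b].

Definition nontrivial (R : realType) (d : measure_display)
    (Y : measurableType d) (nu : {measure set Y -> \bar R})
    (A : set (set Y)) : Prop :=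
  exists2 a, A a & 0 < nu a < 1.

(* [pi : (Y, nu) -> (Z, zeta)] realizes the quotient space Y/A as a standard
   probability space: A is, mod nu, the sigma-algebra of the sets pi^-1 B. *)
Definition is_quotient (R : realType) (d d' : measure_display)
    (Y : measurableType d) (nu : {measure set Y -> \bar R})
    (A : set (set Y))
    (Z : measurableType d') (zeta : {measure set Z -> \bar R})
    (pi : Y -> Z) : Prop :=
  standard_borel R Z /\
  [/\ measurable_fun setT pi,
      forall B, measurable B -> zeta B = nu (pi @^-1` B),
      forall a, A a -> exists2 B, measurable B & eq_mod0 nu a (pi @^-1` B) &
      forall B, measurable B -> exists2 a, A a & eq_mod0 nu a (pi @^-1` B)].

(* [fbar] is the transformation induced by [f] on the quotient given by [p]. *)
Definition is_induced (R : realType) (d d' : measure_display)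
    (W : measurableType d) (V : measurableType d')
    (m : {measure set W -> \bar R}) (p : W -> V)
    (f : W -> W) (fbar : V -> V) : Prop :=
  measurable_fun setT fbar /\ {ae m, forall w, fbar (p w) = p (f w)}.

Definition relatively_isomorphic (R : realType) (d d' : measure_display)
    (X : measurableType d) (Z : measurableType d')
    (mu : probability X R) (zeta : probability Z R)
    (F1 F2 : X * Z -> X * Z) : Prop :=
  exists (U : X -> Z -> Z) (Phi : X * Z -> X * Z),
    [/\ measurable_into_Aut zeta U,
        is_skew_product mu zeta id U Phi,
        automorphism (mu \x zeta) Phi &
        {ae mu \x zeta, forall w, Phi (F1 w) = F2 (Phi w)}].

(* Main.v *)
Require Import Defs.
From HB Require Import structures.
From mathcomp Require Import all_boot all_order all_algebra.
From mathcomp Require Import all_classical all_reals all_analysis.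
From mathcomp Require Import measurable_realfun.
From mathcomp Require Import zify lra.

(* Let E be a non-trivial T_{phi,S}-invariant set with sections E_x, so that
   S_{phi x}^-1 E_{Tx} = E_x mod nu. The sigma-algebra A_x generated by the
   sets S_g^-1 E_x (g in G) is S-invariant, and since G is Abelian,
   A_{Tx} = A_x. The distance from a fixed set to A_x is thus a T-invariant
   function of x; by ergodicity and separability of the measure algebra, A_x
   does not depend on x (mod mu) and is the required factor A. Similarly, the
   joint law of the sets S_g^-1 E_x does not depend on x, so for a fixed x0 the
   correspondence S_g^-1 E_x0 |-> S_g^-1 E_x defines automorphisms R_x of Y/A,
   and S_{phi x} = R_{Tx}^-1 R_x on Y/A.

   Only countably many g are needed, namely a sequence (t n) whose orbit of
   every set is dense in the full orbit; it exists for any family of maps by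
   separability, so neither the topology of G nor the continuity of S is used.
   Then Y/A is realized on the real line by the map y |-> Pi (x0, y), where
   Pi (x, y) encodes the sequence of bits [S_(t n) y in E_x]. *)

Set Implicit Arguments.
Unset Strict Implicit.
Unset Printing Implicit Defensive.

Import Order.TTheory GRing.Theory Num.Theory numFieldNormedType.Exports.
Local Open Scope classical_set_scope.
Local Open Scope ring_scope.

(** * Standard Borel spaces *)

(** The balls of radius 1/(m+1) about a countable dense set yield a countable base of the Polish
    space. Its preimages generate the sigma-algebra, and they separate points because the space is
    metric. *)
Lemma standard_borel_generated (R : realType) d (T : measurableType d) :
  standard_borel R T -> exists G : nat -> set T,
    [/\ forall n, measurable (G n), measurable `<=` <<s range G >> &
        forall x y, (forall n, G n x <-> G n y) -> x = y].
Proof.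
move=> [P [f [_ [D /countable_injP[/= e e_inj] denseD] [g fK gK] mE]]].
pose r (m : nat) : R := m.+1%:R^-1.
have r0 m : (0 < r m)%R by rewrite invr_gt0.
(* As [e] is injective on [D], at most one [q] contributes; the union stands in for an inverse of
   [e]. *)
pose B n m : set P := \bigcup_(q in [set q | D q /\ e q = n]) (ball q (r m))^°.
have oB n m : open (B n m) by apply: bigcup_open => q _; exact: open_interior.
have small p (eps : R) : (0 < eps)%R -> exists n m, B n m p /\ B n m `<=` ball p eps.
  move=> eps0; have [m rm] : exists m, (r m < eps / 2)%R.
    have [m _ /(_ m (leqnn m)) ?] := near_infty_natSinv_lt (PosNum (divr_gt0 eps0 (ltr0n R 2))).
    by exists m.
  have : (ball p (r m / 2))^° !=set0 by exists p; apply: nbhsx_ballx; rewrite divr_gt0 ?r0.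
  move=> /denseD /(_ (@open_interior _ _)) [q [/interior_subset pq Dq]].
  exists (e q), m; split.
    exists q => //; rewrite /interior /= -nbhs_ballE /=; exists (r m / 2)%R; first by rewrite /= divr_gt0 ?r0.
    by move=> t; apply: ball_split; exact: ball_sym.
  move=> t [q' [Dq' eq'] /interior_subset]; rewrite (e_inj q' q) ?inE// => qt.
  apply: (@ball_split _ _ q); last by apply: le_ball qt; exact: ltW.
  apply: le_ball pq; apply: le_trans (ltW rm); rewrite ler_pdivrMr// ler_peMr//.
  - exact: ltW.
  - by rewrite ler1n.
pose G k := f @^-1` (let: (n, m) := odflt (0, 0)%N (unpickle k) in B n m).
have GE n m : G (pickle (n, m)) = f @^-1` (B n m) by rewrite /G pickleK.
exists G; split.
- move=> k; rewrite /G; case: (odflt _ _) => n m; apply/mE.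
  rewrite image_preimage; last by apply/seteqP; split=> // p _; exists (g p).
  by apply: sub_gen_smallest; exact: oB.
- have opG (U : set P) : open U -> <<s range G >> (f @^-1` U).
    move=> oU.
    (* Base sets not contained in the preimage are replaced by the empty set, so that the union runs
       over all [k]. *)
    rewrite (_ : f @^-1` U = \bigcup_k (if `[< G k `<=` f @^-1` U >] then G k else set0)).
      apply: sigma_algebra_bigcup => k; case: ifP => _; last exact: sigma_algebra0.
      by apply: sub_gen_smallest; exists k.
    apply/seteqP; split=> x /=.
      move=> Ufx; have [eps /= eps0 subU] : nbhs_ball (f x) U.
        by rewrite nbhs_ballE; exact: open_nbhs_nbhs.
      have [n [m [Bx Bsub]]] := small (f x) eps eps0.
      exists (pickle (n, m)) => //; rewrite GE ifT//.
      by apply/asboolP => t /= /Bsub /subU.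
    by move=> [k _]; case: ifPn => // /asboolP; exact.
  move=> A /mE sA.
  have -> : A = f @^-1` (f @` A).
    apply/seteqP; split=> x /=; first by exists x.
    by move=> [t At /(can_inj fK) <-].
  suff : <<s @open P >> `<=` image_set_system setT f <<s range G >>.
    by move=> /(_ _ sA); rewrite /image_set_system /= setTI.
  apply: smallest_sub.
    by apply: sigma_algebra_image; exact: smallest_sigma_algebra.
  by move=> U oU; rewrite /image_set_system /= setTI; exact: opG.
- move=> x y xy; apply: contrapT => /eqP nxy.
  (* Some base set around [f x] lies in the ball whose radius is the distance to [f y], hence misses
     [f y]. *)
  have dxy : (0 < mdist (f x) (f y))%R by rewrite mdist_gt0 (inj_eq (can_inj fK)).
  have [n [m [Bx Bsub]]] := small (f x) _ dxy.
  have := xy (pickle (n, m)); rewrite GE => -[/(_ Bx) /Bsub + _].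
  by rewrite ballEmdist /= ltxx.
Qed.

Lemma standard_borel_real (R : realType) : standard_borel R R.
Proof.
exists R^o, id; split.
- move=> F FF Fc; exists (lim F).
  by have := @cauchy_cvg R^o F FF Fc.
- exists (range (@ratr R)); last exact: dense_rat.
  by apply: card_le_trans (card_image_le _ _) _; exact: countableP.
- by exists id.
- move=> A; rewrite image_id; split => mA.
  + have {}mA : (@RGenOpens.G R).-sigma.-measurable A by rewrite -RGenOpens.measurableE.
    move: A mA; apply: smallest_sub; first exact: smallest_sigma_algebra.
    by move=> _ [x [y ->]]; apply: sub_gen_smallest; exact: itv_open.
  + move: A mA; apply: smallest_sub; first exact: sigma_algebra_measurable.
    by move=> U oU; exact: open_measurable.
Qed.

(** * Coding bit sequences by real numbers *)

Section base4.
Context {R : realType}.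

(* With digits 0 and 1 in base 4, the tail never produces a carry: bit n is the
   parity of the integer part of 4^(n+1) r. *)
Fixpoint base4_num (b : nat -> bool) n : nat :=
  if n is m.+1 then (4 * base4_num b m + b m)%N else 0%N.

Definition base4 (b : nat -> bool) : R :=
  limn (fun n => (base4_num b n)%:R / 4 ^+ n : R).

Definition digit (n : nat) : set R :=
  \bigcup_(k in [set k | odd k]) [set r | k%:R <= 4 ^+ n.+1 * r < k.+1%:R].

Let p4 n : (0 < 4 ^+ n :> R)%R. Proof. exact: exprn_gt0. Qed.

Let base4_nondecreasing b : nondecreasing_seq (fun n => (base4_num b n)%:R / 4 ^+ n : R).
Proof.
apply/nondecreasing_seqP => n; rewrite ler_pdivlMr// exprSr mulrA mulfVK ?gt_eqF//.
by rewrite -natrM ler_nat /= mulnC leq_addr.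
Qed.

(** Digits all equal to 1 from place [n] on add 1 / (3 * 4^n), so this is three times the largest
    value reachable from the first [n] digits. *)
Let base4_nonincreasing b :
  nonincreasing_seq (fun n => (base4_num b n * 3 + 1)%:R / 4 ^+ n : R).
Proof.
apply/nonincreasing_seqP => n; rewrite ler_pdivrMr// exprSr mulrA mulfVK ?gt_eqF//.
by rewrite -natrM ler_nat /=; case: (b n); lia.
Qed.

Let base4_bound b n m :
  ((base4_num b m)%:R / 4 ^+ m <= (base4_num b n * 3 + 1)%:R / 4 ^+ n / 3 :> R)%R.
Proof.
have [nm|/ltnW mn] := leqP n m; last first.
  apply: le_trans (base4_nondecreasing b mn) _.
  rewrite ler_pdivlMr// mulrAC ler_wpM2r// ?invr_ge0 ?(ltW (p4 _))//.
  by rewrite -natrM ler_nat leq_addr.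
rewrite ler_pdivlMr//; apply: le_trans (base4_nonincreasing b nm).
rewrite mulrAC ler_wpM2r// ?invr_ge0 ?(ltW (p4 _))//.
by rewrite -natrM ler_nat leq_addr.
Qed.

Lemma base4_cvg b : (fun n => (base4_num b n)%:R / 4 ^+ n : R) @ \oo --> base4 b.
Proof.
apply: nondecreasing_is_cvgn => //.
by exists ((base4_num b 0 * 3 + 1)%:R / 4 ^+ 0 / 3)%R => _ [n _ <-].
Qed.

(** The tail contributes at most a third of a unit of the last place kept, hence the strict upper
    bound. *)
Let base4_itv b n : ((base4_num b n)%:R <= 4 ^+ n * base4 b < (base4_num b n).+1%:R)%R.
Proof.
rewrite mulrC -ler_pdivrMr// -ltr_pdivlMr//; apply/andP; split.
  exact: (nondecreasing_cvgn_le (base4_nondecreasing b) (cvgP _ (@base4_cvg b)) n).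
apply: (@le_lt_trans _ _ ((base4_num b n * 3 + 1)%:R / 4 ^+ n / 3)%R).
  by apply: limr_le; [exact: (cvgP _ (@base4_cvg b))|exact: nearW].
by rewrite ltr_pdivrMr// mulrAC ltr_pM2r ?invr_gt0// -natrM ltr_nat; lia.
Qed.

Lemma base4_digit b n : digit n (base4 b) <-> b n.
Proof.
have /andP[lb ub] := base4_itv b n.+1.
have oddE : odd (base4_num b n.+1) = b n by rewrite /= oddD oddM /= oddb.
split=> [[k /= ok /andP[kl ku]]|bn]; last first.
  by exists (base4_num b n.+1); rewrite /= ?oddE ?lb.
rewrite -oddE; suff -> : base4_num b n.+1 = k by [].
(* Two half-open unit intervals with integer endpoints that share a point coincide. *)
have := le_lt_trans kl ub; have := le_lt_trans lb ku.
by rewrite !ltr_nat !ltnS => *; apply/eqP; rewrite eqn_leq; apply/andP.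
Qed.

Lemma measurable_digit n : measurable (digit n).
Proof.
apply: bigcup_measurable => k _.
rewrite (_ : [set _ | _] = ( *%R (4 ^+ n.+1)) @^-1` `[k%:R, k.+1%:R[%classic); last first.
  by apply/seteqP; split=> r /=; rewrite in_itv.
by rewrite -[X in measurable X]setTI; exact: mulrl_measurable.
Qed.

Lemma measurable_base4 d (T : measurableType d) (W : nat -> set T) :
  (forall n, measurable (W n)) ->
  measurable_fun setT (fun w => base4 (fun n => `[< W n w >])).
Proof.
move=> mW; apply: (@measurable_fun_cvg _ _ _ setT
  (fun n w => (base4_num (fun m => `[< W m w >]) n)%:R / 4 ^+ n)) => [n|w _]; last exact: base4_cvg.
apply: measurable_funM => //; elim: n => [|n ih] //=.
under eq_fun do rewrite natrD natrM.
apply: measurable_funD; first exact: measurable_funM.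
exact: (measurable_indic (U := W n)).
Qed.

End base4.

Local Open Scope ereal_scope.

(** * Measure algebras *)

Lemma measurable_setY d (T : measurableType d) (A B : set T) :
  measurable A -> measurable B -> measurable (A `+` B).
Proof. by move=> mA mB; apply: measurableU; apply: measurableD. Qed.

Lemma setY_subU T (A B C : set T) : A `+` C `<=` (A `+` B) `|` (B `+` C).
Proof. by move=> x; rewrite /setY/=; have [] := pselect (B x); tauto. Qed.

Lemma measure_setY_triangle (R : realType) d (T : measurableType d)
    (m : {measure set T -> \bar R}) (A B C : set T) :
  measurable A -> measurable B -> measurable C ->
  m (A `+` C) <= m (A `+` B) + m (B `+` C).
Proof.
move=> mA mB mC; have mY := measurable_setY.
apply: le_trans (measureU2 _ (mY _ _ _ _ mA mB) (mY _ _ _ _ mB mC)).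
by apply: le_measure; rewrite ?inE; [exact: mY|apply: measurableU; exact: mY|exact: setY_subU].
Qed.

(* The Boolean combinations of the [G n], indexed by a countable type. *)
Fixpoint nor_closure T (G : nat -> set T) (t : GenTree.tree nat) : set T :=
  match t with
  | GenTree.Leaf n => G n
  | GenTree.Node _ s => ~` foldr (fun u A => nor_closure G u `|` A) set0 s
  end.

Lemma measurable_nor_closure d (T : measurableType d) (G : nat -> set T) t :
  (forall n, measurable (G n)) -> measurable (nor_closure G t).
Proof.
move=> mG; elim/GenTree.tree_ind: t => [n|n s ih] /=; first exact: mG.
by apply: measurableC; elim: s ih => //= u s ihs [mu ms]; apply: measurableU => //; exact: ihs.
Qed.

Lemma nonincreasing_measure_lt (R : realType) d (T : measurableType d)
    (m : {measure set T -> \bar R}) (F : (set T)^nat) (eps : R) :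
  m setT < +oo -> (forall n, measurable (F n)) -> nonincreasing_seq F ->
  \bigcap_n F n = set0 -> (0 < eps)%R -> exists n, m (F n) < eps%:E.
Proof.
move=> mT mF nF F0 e0.
have cF : m \o F @ \oo --> m (\bigcap_n F n).
  apply: nonincreasing_cvg_mu => //; last exact: bigcapT_measurable.
  by apply: le_lt_trans mT; apply: le_measure; rewrite ?inE.
rewrite F0 measure0 in cF.
have : \forall x \near nbhs (0 : \bar R), x < eps%:E by apply: open_ereal_lt'; rewrite lte_fin.
by move=> /cF [n _ /(_ n (leqnn n))] ?; exists n.
Qed.

Section approximation.
Context (R : realType) d (T : measurableType d) (C : nat -> set T).
Hypothesis mC : forall k, measurable (C k).
Hypothesis CC : forall k, exists l, C l = ~` C k.
Hypothesis CU : forall k l, exists j, C j = C k `|` C l.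

(** Finite unions inherit approximations from the algebra [C]; since [m] is finite, the rest of a
    countable union is eventually small. *)
Lemma approx_sigma_algebra (m : {measure set T -> \bar R}) : m setT < +oo ->
  sigma_algebra setT [set A | measurable A /\
    forall eps : R, (0 < eps)%R -> exists k, m (A `+` C k) < eps%:E].
Proof.
move=> mT; have mY := measurable_setY.
have C0 : exists k, C k = set0.
  have [l Cl] := CC 0; have [j Cj] := CU 0 l; have [k Ck] := CC j.
  by exists k; rewrite Ck Cj Cl setUv setCT.
have half (e : R) : (0 < e)%R -> (0 < e / 2)%R by move=> e0; rewrite divr_gt0.
split.
- split=> // e e0; have [k Ck] := C0; exists k.
  by rewrite Ck setYK measure0 lte_fin.
- move=> A [mA hA]; rewrite setTD; split; first exact: measurableC.
  move=> e /hA[k Ak]; have [l Cl] := CC k; exists l.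
  rewrite Cl (_ : ~` A `+` _ = A `+` C k)//.
  by apply/seteqP; split=> x; rewrite /setY /=; have [] := pselect (A x);
    have [] := pselect (C k x); tauto.
- move=> A hA; have mA n : measurable (A n) by have [] := hA n.
  have mU : measurable (\bigcup_n A n) by exact: bigcupT_measurable.
  split=> // e e0.
  pose F n := \bigcup_(i in `I_n) A i.
  have mF n : measurable (F n) by apply: bigcup_measurable => i _.
  have hF n (e' : R) : (0 < e')%R -> exists k, m (F n `+` C k) < e'%:E.
    elim: n e' => [|n ih] e' e'0.
      have [k Ck] := C0; exists k.
      by rewrite /F II0 bigcup_set0 Ck setYK measure0 lte_fin.
    have [k Fk] := ih _ (half _ e'0).
    have [l Al] := (hA n).2 _ (half _ e'0).
    have [j Cj] := CU k l; exists j; rewrite Cj.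
    have FS : F n.+1 = F n `|` A n.
      by rewrite /F IIS bigcup_setU bigcup_set1.
    apply: (@le_lt_trans _ _ (m ((F n `+` C k) `|` (A n `+` C l)))).
      apply: le_measure; rewrite ?inE.
      + by apply: mY => //; exact: measurableU.
      + by apply: measurableU; exact: mY.
      + by rewrite FS => x; rewrite /setY /=; tauto.
    apply: le_lt_trans (measureU2 _ (mY _ _ _ _ (mF n) (mC k)) (mY _ _ _ _ (mA n) (mC l))) _.
    by rewrite [e' in _ < e'%:E]splitr EFinD; apply: lteD.
  (* Half of the error pays for truncating the union, the other half for approximating the finite
     union. *)
  have [n Dn] : exists n, m (\bigcup_n A n `\` F n) < (e / 2)%:E.
    apply: nonincreasing_measure_lt => //.
    - by move=> n; exact: measurableD.
    - apply/nonincreasing_seqP => n; apply/subsetPset; apply: setDS.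
      by apply: bigcup_sub => i /= ni; apply: bigcup_sup => /=; exact: ltnW.
    - apply/seteqP; split=> // x hx; have [[i _ Aix] _] := hx 0%N Logic.I.
      by have [_] := hx i.+1 Logic.I; apply; exists i => //=.
    - exact: half.
  have [k Fk] := hF n _ (half _ e0).
  exists k; apply: le_lt_trans (measure_setY_triangle m mU (mF n) (mC k)) _.
  rewrite [e in _ < e%:E]splitr EFinD; apply: lteD => //.
  rewrite /setY (_ : F n `\` _ = set0) ?setU0//.
  by apply/seteqP; split=> // x [[i /= ? ?]]; apply; exists i.
Qed.

End approximation.

(** The sequence is chosen before the measure, so that one sequence serves all finite measures at
    once: sums of two laws, and the laws on all fibers. *)
Lemma dense_sequence d (T : measurableType d) (G : nat -> set T) :
  (forall n, measurable (G n)) -> measurable `<=` <<s range G >> ->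
  exists C : nat -> set T, (forall k, measurable (C k)) /\
    forall (R : realType) (m : {measure set T -> \bar R}) A (eps : R),
      m setT < +oo -> measurable A -> (0 < eps)%R ->
      exists k, m (A `+` C k) < eps%:E.
Proof.
move=> mG sG.
pose t k : GenTree.tree nat := odflt (GenTree.Leaf 0%N) (unpickle k).
pose C k := nor_closure G (t k).
have CE u : C (pickle u) = nor_closure G u by rewrite /C /t pickleK.
have mC k : measurable (C k) by exact: measurable_nor_closure.
exists C; split => // R m A e mT mA e0.
have CC k : exists l, C l = ~` C k.
  by exists (pickle (GenTree.Node 0 [:: t k])); rewrite CE /= setU0.
have CU k l : exists j, C j = C k `|` C l.
  have [i Ci] : exists i, C i = ~` (C k `|` C l).
    by exists (pickle (GenTree.Node 0 [:: t k; t l])); rewrite CE /= setU0.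
  by have [j Cj] := CC i; exists j; rewrite Cj Ci setCK.
have sub := @smallest_sub _ _ _ _ (approx_sigma_algebra mC CC CU mT) _ A (sG _ mA).
have [|_] := sub; last exact.
move=> _ [n _ <-]; split => // e' e'0.
by exists (pickle (GenTree.Leaf n : GenTree.tree nat)); rewrite CE /= setYK measure0 lte_fin.
Qed.

(** * Almost everywhere statements and their transport along measure-preserving maps *)

Section almost_everywhere.
Context (R : realType) d d' (T : measurableType d) (T' : measurableType d').

Lemma measurable_preimage (f : T -> T') A :
  measurable_fun setT f -> measurable A -> measurable (f @^-1` A).
Proof. by move=> mf mA; rewrite -[_ @^-1` _]setTI; exact: mf. Qed.

Lemma eq_mod0_ae (m : {measure set T -> \bar R}) (A B : set T) :
  measurable A -> measurable B ->
  eq_mod0 m A B <-> {ae m, forall x, A x <-> B x}.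
Proof.
move=> mA mB; have mY := measurable_setY mA mB.
rewrite /eq_mod0 -(negligibleP _ mY) /almost_everywhere.
rewrite (_ : A `+` B = ~` [set x | A x <-> B x])//.
by apply/seteqP; split=> x; rewrite /setY /=; have [] := pselect (A x);
  have [] := pselect (B x); tauto.
Qed.

Lemma ae_exists (m : probability T R) (P : T -> Prop) :
  {ae m, forall x, P x} -> exists x, P x.
Proof.
move=> mP; apply: contrapT => nP; have [N [mN N0 subN]] := mP.
have NT : N = setT by apply/seteqP; split=> // x _; apply: subN => Px; apply: nP; exists x.
by move: N0; rewrite NT probability_setT => /eqP; rewrite onee_eq0.
Qed.

Context (m : {measure set T -> \bar R}) (m' : {measure set T' -> \bar R}).

Lemma ae_preimage (f : T -> T') (P : T' -> Prop) : measurable_fun setT f ->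
  (forall A, measurable A -> m (f @^-1` A) = m' A) ->
  {ae m', forall x, P x} -> {ae m, forall x, P (f x)}.
Proof.
move=> mf fm [N [mN N0 subN]]; exists (f @^-1` N); split.
- exact: measurable_preimage.
- by rewrite fm.
- by move=> x nP; exact: subN.
Qed.

Lemma ae_image (f : T -> T') (P : T' -> Prop) : measurable_fun setT f ->
  (forall A, measurable A -> m (f @^-1` A) = m' A) -> measurable [set x | P x] ->
  {ae m, forall x, P (f x)} -> {ae m', forall x, P x}.
Proof.
move=> mf fm mP aeP; exists (~` [set x | P x]); split => //; first exact: measurableC.
rewrite -fm; last exact: measurableC.
apply: measure_negligible; last exact: aeP.
by apply: measurable_preimage => //; exact: measurableC.
Qed.

End almost_everywhere.

(** Countably many sets separate the points of [Z], so equality is a countable conjunction of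
    measurable conditions. *)
Lemma measurable_eq_fun (R : realType) d d' (T : measurableType d)
    (Z : measurableType d') (f g : T -> Z) :
  standard_borel R Z -> measurable_fun setT f -> measurable_fun setT g ->
  measurable [set x | f x = g x].
Proof.
move=> /standard_borel_generated[G [mG _ sepG]] mf mg.
rewrite (_ : [set x | f x = g x] = \bigcap_n ~` (f @^-1` G n `+` g @^-1` G n)).
  apply: bigcapT_measurable => n; apply: measurableC.
  by apply: measurable_setY; exact: measurable_preimage.
apply/seteqP; split=> x /=; first by move=> fg n _; rewrite /setY /= fg; tauto.
move=> h; apply: sepG => n; have := h n Logic.I; rewrite /setY /=.
by have [] := pselect (G n (f x)); have [] := pselect (G n (g x)); tauto.
Qed.

(** * Null sets of a product through their sections *)

Section fubini.
Context (R : realType) dX dY (X : measurableType dX) (Y : measurableType dY).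
Context (mu : probability X R) (nu : probability Y R).

Lemma xsectionE (A : set (X * Y)) x : xsection A x = [set y | A (x, y)].
Proof. by apply/seteqP; split=> y /=; rewrite /xsection /= inE. Qed.

Lemma measurable_section (A : set (X * Y)) x :
  measurable A -> measurable [set y | A (x, y)].
Proof. by move=> mA; rewrite -xsectionE; exact: measurable_xsection. Qed.

Lemma measurable_fun_section (A : set (X * Y)) : measurable A ->
  measurable_fun setT (fun x => nu [set y | A (x, y)]).
Proof.
move=> mA; under eq_fun do rewrite -xsectionE.
exact: measurable_fun_xsection.
Qed.

Lemma product_section (A : set (X * Y)) :
  (mu \x nu) A = \int[mu]_x nu [set y | A (x, y)].
Proof. by rewrite /product_measure1 /=; apply: eq_integral => x _; rewrite /= xsectionE. Qed.

Lemma product_eq0 (A : set (X * Y)) : measurable A ->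
  (mu \x nu) A = 0 <-> {ae mu, forall x, nu [set y | A (x, y)] = 0}.
Proof.
move=> mA; rewrite product_section.
have -> : \int[mu]_x nu [set y | A (x, y)] = \int[mu]_x `|nu [set y | A (x, y)]|.
  by apply: eq_integral => x _; rewrite gee0_abs.
rewrite ae_eq_integral_abs//; last exact: measurable_fun_section.
by split; apply: filterS => x; [apply|move=> ? _].
Qed.

Lemma ae_productW (P : X * Y -> Prop) : {ae mu \x nu, forall w, P w} ->
  {ae mu, forall x, {ae nu, forall y, P (x, y)}}.
Proof.
move=> [N [mN N0 subN]]; move/(product_eq0 mN): N0; apply: filterS => x Nx.
exists [set y | N (x, y)]; split => //; first exact: measurable_section.
by move=> y nP; exact: subN.
Qed.

Lemma ae_product (P : X * Y -> Prop) : measurable [set w | P w] ->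
  {ae mu, forall x, {ae nu, forall y, P (x, y)}} -> {ae mu \x nu, forall w, P w}.
Proof.
move=> mP h; exists (~` [set w | P w]); split => //; first exact: measurableC.
apply/product_eq0; first exact: measurableC.
apply: filterS h => x; apply: measure_negligible.
by apply: (@measurable_section (~` [set w | P w])); exact: measurableC.
Qed.

End fubini.

(** * Sets whose sections factor through a map, measurably in the base point *)

Section factorization.
Context (R : realType) dX dY dZ (X : measurableType dX) (Y : measurableType dY)
  (Z : measurableType dZ).
Context (mu : probability X R) (nu : probability Y R) (Pi : X * Y -> Z).
Hypothesis mPi : measurable_fun setT Pi.
Context (C : nat -> set Z).
Hypothesis mC : forall k, measurable (C k).

(** For a dense sequence [C], this says that almost every section of [W] lies, modulo null sets, in
    the sigma-algebra generated by [Pi (x, _)]. *)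
Definition fiber_approximable (W : set (X * Y)) :=
  {ae mu, forall x, forall eps : R, (0 < eps)%R -> exists k,
    nu ([set y | W (x, y)] `+` [set y | C k (Pi (x, y))]) < eps%:E}.

(** For a single x, a limit of the approximating sets [C k] would do; the point is to obtain a set
    jointly measurable in x and z. *)
Lemma fiber_approximable_factor (W : set (X * Y)) :
  measurable W -> fiber_approximable W ->
  exists D : set (X * Z), measurable D /\
    {ae mu, forall x, {ae nu, forall y, W (x, y) <-> D (x, Pi (x, y))}}.
Proof.
move=> mW appW.
pose eps n : R := (1 / (2 ^ n.+1)%:R)%R.
have eps0 n : (0 < eps n)%R by rewrite divr_gt0 ?ltr0n ?expn_gt0.
pose Q n j : set X :=
  [set x | nu ([set y | W (x, y)] `+` [set y | C j (Pi (x, y))]) < (eps n)%:E].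
have mPiC j : measurable (Pi @^-1` C j) by exact: measurable_preimage.
have mQ n j : measurable (Q n j).
  have := emeasurable_fun_infty_o measurableT
    (measurable_fun_section nu (measurable_setY mW (mPiC j))) (eps n)%:E.
  by rewrite setTI.
(* The least j in Q n depends measurably on x; by Borel-Cantelli the
   corresponding approximations converge almost everywhere to W. *)
pose first n j := Q n j `\` \bigcup_(i in `I_j) Q n i.
have mfirst n j : measurable (first n j).
  by apply: measurableD => //; apply: bigcup_measurable.
pose V n := \bigcup_j (first n j `*` C j).
have mV n : measurable (V n).
  by apply: bigcupT_measurable => j; exact: measurableX.
exists (lim_sup_set V); split.
  by apply: bigcapT_measurable => n; apply: bigcup_measurable.
move: appW; rewrite /fiber_approximable; apply: filterS => x appx.
have mPix : measurable_fun setT (fun y => (x, Pi (x, y))).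
  apply: measurable_fun_pair => //.
  by apply: measurableT_comp => //; exact: pair1_measurable.
have mWx : measurable [set y | W (x, y)] by exact: measurable_section.
pose B n := [set y | W (x, y)] `+` [set y | V n (x, Pi (x, y))].
have mB n : measurable (B n).
  by apply: measurable_setY => //; exact: (measurable_preimage mPix (mV n)).
have nuB n : nu (B n) < (eps n)%:E.
  have exQ : exists j, `[< Q n j x >].
    by have [j Qj] := appx _ (eps0 n); exists j; apply/asboolP.
  case: (ex_minnP exQ) => j /asboolP Qj minj.
  have fj : first n j x.
    by split=> // -[i /= ij /asboolP /minj]; rewrite leqNgt ij.
  rewrite /B (_ : [set y | V n _] = [set y | C j (Pi (x, y))])//.
  apply/seteqP; split=> y /=; last by exists j.
  move=> [i _ [/= [Qi nQi] Ci]]; suff -> : j = i by [].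
  apply/eqP; rewrite eqn_leq minj /=; last exact/asboolP.
  by rewrite leqNgt; apply/negP => ji; apply: nQi; exists j.
(* The errors 1/2^(n+1) sum to 1, so the Borel-Cantelli lemma applies. *)
have : nu (lim_sup_set B) = 0.
  apply: lim_sup_set_cvg0 => //.
  apply: (@le_lt_trans _ _ 1%:E); last by rewrite ltry.
  apply: le_trans (@epsilon_trick0 R 1 xpredT _) => //.
  by apply: lee_nneseries => [i _ _|i _]; [exact: measure_ge0|exact: ltW (nuB i)].
move=> B0; exists (lim_sup_set B); split => //.
  by apply: bigcapT_measurable => n; apply: bigcup_measurable.
move=> y /=; apply: contra_notP => /existsNP[n nB].
(* Off the limit superior of the errors, [W] and [V k] agree at y for all large [k]. *)
have WV k : (n <= k)%N -> W (x, y) <-> V k (x, Pi (x, y)).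
  move=> nk; have nBk : ~ B k y by move=> Bk; apply: nB => _; exists k.
  move: nBk; rewrite /B /setY /=; have [] := pselect (W (x, y));
    have [] := pselect (V k (x, Pi (x, y))); tauto.
split=> [Wxy k _|/(_ n Logic.I)[k /= nk]]; last by move/WV; exact.
by exists (maxn n k); [exact: leq_maxr|apply/WV => //; exact: leq_maxl].
Qed.

(** Coding all the factored sets in one real number turns countably many factorizations into one
    map; the maps between fibers arise in this way. *)
Lemma fiber_approximable_base4 (W : nat -> set (X * Y)) :
  (forall n, measurable (W n)) -> (forall n, fiber_approximable (W n)) ->
  exists2 f : X * Z -> R, measurable_fun setT f &
    {ae mu, forall x, {ae nu, forall y,
      f (x, Pi (x, y)) = base4 (fun n => `[< W n (x, y) >])}}.
Proof.
move=> mW appW.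
have /choice[D DW] := fun n => fiber_approximable_factor (mW n) (appW n).
exists (fun w => base4 (fun n => `[< D n w >])).
  by apply: measurable_base4 => n; have [] := DW n.
have aeD n := (DW n).2.
apply: filterS (ae_foralln aeD) => x /ae_foralln; apply: filterS => y WD.
by congr base4; apply/funext => n; apply/asbool_equiv_eq; split=> /WD.
Qed.

End factorization.

(** * Invariant sets of skew products *)

(** Modulo null sets [L] is contained in its preimage, which has the same finite measure, so the two
    agree and ergodicity applies. The equivalence with [mu L = 1] covers the null and the full case
    together. *)
Lemma ergodic_subinvariant (R : realType) d (X : measurableType d)
    (mu : probability X R) (T : X -> X) (L : set X) :
  measurable_fun setT T -> (forall A, measurable A -> mu (T @^-1` A) = mu A) ->
  ergodic mu T -> measurable L -> {ae mu, forall x, L x -> L (T x)} ->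
  {ae mu, forall x, L x <-> mu L = 1}.
Proof.
move=> mT muT erg mL LT.
have mTL : measurable (T @^-1` L) by exact: measurable_preimage.
have D1 : mu (L `\` T @^-1` L) = 0.
  apply: measure_negligible; first exact: measurableD.
  by apply: negligibleS LT => x /= [Lx nTLx] /(_ Lx).
have D2 : mu (T @^-1` L `\` L) = 0.
  have E1 : mu L = mu (L `\` T @^-1` L) + mu (L `&` T @^-1` L) by exact: measureDI.
  have E2 : mu (T @^-1` L) = mu (T @^-1` L `\` L) + mu (T @^-1` L `&` L) by exact: measureDI.
  move: E2; rewrite muT// setIC E1 D1 add0e => E2.
  have fI : mu (L `&` T @^-1` L) \is a fin_num by rewrite fin_num_measure//; exact: measurableI.
  by rewrite -(addeK (mu (T @^-1` L `\` L)) fI) -E2 subee.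
have : eq_mod0 mu (T @^-1` L) L.
  by rewrite /eq_mod0 /setY measureU0 //; apply: measurableD.
move=> /(erg _ mL)[] muL; rewrite muL.
- exists L; split=> // x /=; apply: contra_notP => nL; split=> // /eqP.
  by rewrite eq_sym onee_eq0.
- exists (~` L); split; first exact: measurableC.
    by rewrite probability_setC// muL subee.
  by move=> x /=; apply: contra_not => Lx.
Qed.

(** Each level set below a rational is null or full, so almost all points lie in the same ones, and
    rationals separate values of [f]. *)
Lemma ergodic_invariant_cst (R : realType) d (X : measurableType d)
    (mu : probability X R) (T : X -> X) (f : X -> R) :
  measurable_fun setT T -> (forall A, measurable A -> mu (T @^-1` A) = mu A) ->
  ergodic mu T -> measurable_fun setT f -> {ae mu, forall x, f (T x) = f x} ->
  exists c, {ae mu, forall x, f x = c}.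
Proof.
move=> mT muT erg mf fT.
pose L (q : rat) := [set x | (f x < ratr q)%R].
have aeL n : {ae mu, forall x, forall q, unpickle n = Some q -> (L q x <-> mu (L q) = 1)}.
  case: (unpickle n) => [q|]; last by apply: aeW.
  have : {ae mu, forall x, L q x <-> mu (L q) = 1}.
    apply: ergodic_subinvariant erg _ _ => //.
    - rewrite (_ : L q = f @^-1` `]-oo, ratr q[%classic).
        exact: measurable_preimage.
      by apply/seteqP; split=> x /=; rewrite in_itv.
    - by apply: filterS fT => x; rewrite /L /= => ->.
  by apply: filterS => x Lx _ [<-].
have {}aeL : {ae mu, forall x, forall q, L q x <-> mu (L q) = 1}.
  by apply: filterS (ae_foralln aeL) => x Lx q; apply: (Lx (pickle q)); rewrite pickleK.
have [x0 Lx0] := ae_exists aeL.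
exists (f x0); apply: filterS aeL => x Lx.
have LL q : L q x <-> L q x0 by rewrite Lx Lx0.
case: (ltgtP (f x) (f x0)) => [lt|lt|//].
- have [q] := rat_in_itvoo lt; rewrite in_itv /= => /andP[/LL]; rewrite /L /= => ? ?; lra.
- have [q] := rat_in_itvoo lt; rewrite in_itv /= => /andP[/LL]; rewrite /L /= => ? ?; lra.
Qed.

Lemma dense_orbit_sequence (R : realType) d (Y : measurableType d)
    (nu : probability Y R) (G : Type) (g0 : G) (S : G -> Y -> Y) :
  standard_borel R Y -> (forall g, measurable_fun setT (S g)) ->
  (forall g A, measurable A -> nu (S g @^-1` A) = nu A) ->
  exists t : nat -> G, forall g A (eps : R), measurable A -> (0 < eps)%R ->
    exists n, nu (S (t n) @^-1` A `+` S g @^-1` A) < eps%:E.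
Proof.
move=> /standard_borel_generated[B0 [mB0 genB0 _]] mS nuS.
have [B [mB dB]] := dense_sequence mB0 genB0.
have nuT : nu setT < +oo by rewrite probability_setT ltry.
have mSA g A : measurable A -> measurable (S g @^-1` A) by exact: measurable_preimage.
(* It suffices to keep, whenever possible, one g for which the preimage of B k
   is close to B l: the triangle inequality through B l compares two of them. *)
pose P (i : nat * nat * nat) g :=
  nu (S g @^-1` B i.1.1 `+` B i.1.2) < (i.2.+1%:R^-1)%:E.
have exP i : exists g, (exists g', P i g') -> P i g.
  by have [[g Pg]|nP] := pselect (exists g', P i g'); [exists g|exists g0].
have [t Pt] := choice exP.
exists (fun n => t (odflt (0, 0, 0)%N (unpickle n))) => g A eps mA eps0.
(* A quarter of [eps]: the chain from the preimage of [A] under [S h] to that under [S g] passes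
   through two preimages of [B k] and through [B l], which makes four links. *)
have [m _ /(_ m (leqnn m)) meps] :=
  near_infty_natSinv_lt (PosNum (divr_gt0 eps0 (ltr0n R 4))).
pose r : R := m.+1%:R^-1%R.
have r0 : (0 < r)%R by rewrite invr_gt0.
have [k Ak] : exists k, nu (A `+` B k) < r%:E by exact: dB.
have [l Bl] : exists l, nu (S g @^-1` B k `+` B l) < r%:E by exact: dB (mSA _ _ (mB k)) r0.
exists (pickle (k, l, m)); rewrite pickleK /=; set h := t _.
have {}Pt : nu (S h @^-1` B k `+` B l) < r%:E by apply: (Pt (k, l, m)); exists g.
have tri U V W : measurable U -> measurable V -> measurable W ->
    nu (U `+` W) <= nu (U `+` V) + nu (V `+` W).
  exact: measure_setY_triangle.
have nuSY s : nu (S s @^-1` A `+` S s @^-1` B k) < r%:E.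
  by rewrite -(nuS s (A `+` B k)) in Ak; last exact: measurable_setY.
have mShA := mSA h A mA.
have mSgA := mSA g A mA.
have mShB := mSA h _ (mB k).
have mSgB := mSA g _ (mB k).
apply: (@le_lt_trans _ _ (nu (S h @^-1` A `+` S h @^-1` B k) +
    (nu (S h @^-1` B k `+` B l) + (nu (S g @^-1` B k `+` B l) +
    nu (S g @^-1` A `+` S g @^-1` B k))))).
  apply: le_trans (tri _ _ _ mShA mShB mSgA) _; rewrite leeD2l//.
  apply: le_trans (tri _ _ _ mShB (mB l) mSgA) _; rewrite leeD2l//.
  apply: le_trans (tri _ _ _ (mB l) mSgB mSgA) _.
  by rewrite (setYC (B l)) (setYC _ (S g @^-1` A)).
apply: (@lt_trans _ _ (r%:E + (r%:E + (r%:E + r%:E)))).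
  by do !apply: lteD => //.
rewrite -!EFinD lte_fin; move: meps; rewrite /= -/r; lra.
Qed.

(** * Comparing measures of sets that agree almost everywhere or approximately *)

Lemma eq_measure_ae (R : realType) d (T : measurableType d)
    (m : {measure set T -> \bar R}) (A B : set T) :
  measurable A -> measurable B -> {ae m, forall x, A x <-> B x} -> m A = m B.
Proof.
move=> mA mB AB; have sub U V : measurable U -> measurable V ->
    {ae m, forall x, U x <-> V x} -> m U <= m V.
  move=> mU mV UV; have UV0 : m (U `\` V) = 0.
    apply: measure_negligible; first exact: measurableD.
    by apply: negligibleS UV => x /= [Ux nVx] [/(_ Ux)].
  have -> : m U = m (U `\` V) + m (U `&` V) by exact: measureDI.
  by rewrite UV0 add0e; apply: le_measure; rewrite ?inE//; exact: measurableI.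
by apply/eqP; rewrite eq_le !sub//; apply: filterS AB => x; tauto.
Qed.

Lemma measure_setY_ae (R : realType) d (T : measurableType d)
    (m : {measure set T -> \bar R}) (A A' B B' : set T) :
  measurable A -> measurable A' -> measurable B -> measurable B' ->
  {ae m, forall x, A x <-> A' x} -> {ae m, forall x, B x <-> B' x} ->
  m (A `+` B) = m (A' `+` B').
Proof.
move=> mA mA' mB mB' AA' BB'; apply: eq_measure_ae; try exact: measurable_setY.
by apply: filterS2 AA' BB' => x; rewrite /setY /=; tauto.
Qed.

Lemma measure_le_setY (R : realType) d (T : measurableType d)
    (m : {measure set T -> \bar R}) (A B : set T) :
  measurable A -> measurable B -> m A <= m B + m (A `+` B).
Proof.
move=> mA mB; have mY := measurable_setY mA mB.
apply: le_trans (measureU2 m mB mY); apply: le_measure; rewrite ?inE//.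
  exact: measurableU.
by move=> x; rewrite /setY /=; have [] := pselect (B x); tauto.
Qed.

Lemma image_probability (R : realType) d d' (T : measurableType d)
    (T' : measurableType d') (m : probability T R) (f : T -> T') :
  measurable_fun setT f ->
  exists m' : probability T' R, forall A, m' A = m (f @^-1` A).
Proof. by move=> mf; exists (distribution m (mfun_Sub (mem_set mf))). Qed.

(** Approximating [A] with respect to the sum of the two measures gives a single [C k] close to [A]
    for both. *)
Lemma probability_eq_dense (R : realType) d (T : measurableType d)
    (C : nat -> set T) (m m' : probability T R) :
  (forall k, measurable (C k)) ->
  (forall (m : {measure set T -> \bar R}) A (eps : R),
    m setT < +oo -> measurable A -> (0 < eps)%R ->
    exists k, m (A `+` C k) < eps%:E) ->
  (forall k, m (C k) = m' (C k)) -> forall A, measurable A -> m A = m' A.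
Proof.
move=> mC dC mm' A mA.
suff le (m1 m2 : probability T R) : (forall k, m1 (C k) = m2 (C k)) -> m1 A <= m2 A.
  by apply/eqP; rewrite eq_le !le.
move=> m12; apply/lee_addgt0Pr => e e0.
have e20 : (0 < e / 2)%R by rewrite divr_gt0.
pose ms : {measure set T -> \bar R} := measure_add m1 m2.
have msE B : ms B = m1 B + m2 B by exact: measure_addE.
have [|k] := dC ms A _ _ mA e20; first by rewrite msE !probability_setT ltry.
rewrite msE => Ak; have mY := measurable_setY mA (mC k).
have Ak1 : m1 (A `+` C k) <= (e / 2)%:E.
  by apply: le_trans (ltW Ak); rewrite leeDl.
have Ak2 : m2 (C k `+` A) <= (e / 2)%:E.
  by rewrite setYC; apply: le_trans (ltW Ak); rewrite leeDr.
have le1 : m1 A <= m1 (C k) + m1 (A `+` C k) by exact: measure_le_setY.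
have le2 : m2 (C k) <= m2 A + m2 (C k `+` A) by exact: measure_le_setY.
apply: le_trans le1 _.
rewrite m12 [e in m2 A + e%:E]splitr EFinD addeA; apply: leeD => //.
by apply: le_trans le2 _; rewrite leeD2l.
Qed.

(** * The orbit code of an invariant set and its dependence on the base point *)

Section skew_product.
Context (R : realType) dX dY (X : measurableType dX) (Y : measurableType dY).
Context (mu : probability X R) (nu : probability Y R) (G : zmodType).
Context (T : X -> X) (phi : X -> G) (S : G -> Y -> Y).
Hypothesis mT : measurable_fun setT T.
Hypothesis muT : forall A, measurable A -> mu (T @^-1` A) = mu A.
Hypothesis ergT : ergodic mu T.
Hypothesis mS : forall g, measurable_fun setT (S g).
Hypothesis nuS : forall g A, measurable A -> nu (S g @^-1` A) = nu A.
Hypothesis SD : forall g h, {ae nu, forall y, S (g + h)%R y = S g (S h y)}.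
Context (E : set (X * Y)).
Hypothesis mE : measurable E.
Hypothesis invE :
  {ae mu, forall x, {ae nu, forall y, E (x, y) <-> E (T x, S (phi x) y)}}.
Context (t : nat -> G).
Hypothesis dense_t : forall g A (eps : R), measurable A -> (0 < eps)%R ->
  exists n, nu (S (t n) @^-1` A `+` S g @^-1` A) < eps%:E.

Definition orbit_code (w : X * Y) : R :=
  base4 (fun n => `[< E (w.1, S (t n) w.2) >]).

Let Pi := orbit_code.

Let mES g : measurable [set w | E (w.1, S g w.2)].
Proof.
apply: (@measurable_preimage _ _ _ _ (fun w => (w.1, S g w.2)) E) => //.
by apply: measurable_fun_pair => //; exact: measurableT_comp.
Qed.

Lemma measurable_orbit_code : measurable_fun setT Pi.
Proof. exact: (measurable_base4 (fun n => mES (t n))). Qed.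

Let mPi x : measurable_fun setT (fun y => Pi (x, y)).
Proof. by apply: measurableT_comp; [exact: measurable_orbit_code|exact: pair1_measurable]. Qed.

Let digit_Pi n x y : digit n (Pi (x, y)) <-> E (x, S (t n) y).
Proof. by rewrite base4_digit asboolE. Qed.

(** Commutativity of [G] enters here: [S (t n)] and [S (phi x)] commute almost everywhere, and
    invariance of [E] at [S (t n) y] then equates the bits. *)
Lemma orbit_code_equivariant :
  {ae mu, forall x, {ae nu, forall y, Pi (T x, S (phi x) y) = Pi (x, y)}}.
Proof.
apply: filterS invE => x invx.
have : {ae nu, forall y, forall n, E (x, S (t n) y) <-> E (T x, S (t n) (S (phi x) y))}.
  apply: ae_foralln => n.
  have := ae_preimage (mS (t n)) (nuS (t n)) invx.
  apply: filterS3 (SD (phi x) (t n)) (SD (t n) (phi x)) => y.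
  by rewrite addrC => -> -> ->.
by apply: filterS => y Ey; congr base4; apply/funext => n; apply/asbool_equiv_eq; split=> /Ey.
Qed.

(** This is the invariance of the sigma-algebra generated by [Pi (x, _)]. Bit n of [Pi (x, S g y)]
    tells whether S_(t n + g) y lies in E_x, and by density of the orbit sequence it is approximated
    by bits of [Pi (x, y)]. *)
Lemma orbit_code_factor x g : exists2 rho : R -> R, measurable_fun setT rho &
  {ae nu, forall y, rho (Pi (x, y)) = Pi (x, S g y)}.
Proof.
(* The first coordinate of [w] is a dummy, since [x] is fixed; any good value [x'] of it is inserted
   at the end. *)
pose W n := [set w : X * Y | E (x, S (t n) (S g w.2))].
have mW n : measurable (W n).
  apply: (@measurable_preimage _ _ _ _ (fun w => (x, S (t n) (S g w.2))) E) => //.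
  by apply: measurable_fun_pair => //; do 2!apply: measurableT_comp => //.
have mP : measurable_fun setT (fun w : X * Y => Pi (x, w.2)).
  exact: measurableT_comp (mPi x) measurable_snd.
have [n|f mf] := fiber_approximable_base4 (mu := mu) (nu := nu) mP measurable_digit mW.
  apply: aeW => x' eps eps0.
  have mEx : measurable [set y | E (x, y)] by exact: measurable_section.
  have [k] := dense_t (t n + g) mEx eps0.
  exists k; rewrite setYC (@measure_setY_ae _ _ _ nu _ (S (t k) @^-1` [set y | E (x, y)])
    _ (S (t n + g)%R @^-1` [set y | E (x, y)])) //.
  - by apply: (measurable_preimage (mPi x)); exact: measurable_digit.
  - exact: measurable_preimage.
  - exact: (measurable_section x' (mW n)).
  - exact: measurable_preimage.
  - by apply: aeW => y; exact: digit_Pi.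
  - by apply: filterS (SD (t n) g) => y /= ->.
move=> /ae_exists[x' fx']; exists (fun z => f (x', z)) => //.
by apply: measurableT_comp => //; exact: pair1_measurable.
Qed.

Context (C : nat -> set R).
Hypothesis mC : forall k, measurable (C k).
Hypothesis dense_C : forall (m : {measure set R -> \bar R}) A (eps : R),
  m setT < +oo -> measurable A -> (0 < eps)%R ->
  exists k, m (A `+` C k) < eps%:E.

Let mPiC x A : measurable A -> measurable [set y | A (Pi (x, y))].
Proof. exact: (measurable_preimage (mPi x)). Qed.

(** The law of [Pi (x, _)] gives each [C k] a measure that is [T]-invariant in x, hence almost
    everywhere constant; a law is determined by its values on the dense sequence. *)
Lemma orbit_code_law : exists P : X -> Prop, {ae mu, forall x, P x} /\
  forall x x', P x -> P x' -> forall A, measurable A ->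
    nu [set y | A (Pi (x, y))] = nu [set y | A (Pi (x', y))].
Proof.
pose f k x := fine (nu [set y | C k (Pi (x, y))]).
have mf k : measurable_fun setT (f k).
  apply: measurableT_comp => //.
  exact: measurable_fun_section (measurable_preimage measurable_orbit_code (mC k)).
have /choice[c fc] k : exists c, {ae mu, forall x, f k x = c}.
  apply: (ergodic_invariant_cst mT muT ergT (mf k)).
  apply: filterS orbit_code_equivariant => x Px; congr fine.
  rewrite -(nuS (phi x)); last exact: mPiC.
  apply: eq_measure_ae; [|exact: mPiC|by apply: filterS Px => y /= ->].
  by apply: measurable_preimage => //; exact: mPiC.
exists (fun x => forall k, f k x = c k); split; first exact: ae_foralln.
move=> x x' Px Px' A mA.
have [m mE'] := image_probability nu (mPi x).
have [m' m'E'] := image_probability nu (mPi x').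
have := @probability_eq_dense _ _ _ C m m' mC dense_C _ A mA.
rewrite mE' m'E'; apply => k; rewrite mE' m'E'.
have fin u : nu [set y | C k (Pi (u, y))] \is a fin_num.
  by rewrite fin_num_measure//; exact: mPiC.
by rewrite -(fineK (fin x)) -(fineK (fin x')) [fine _](Px k) [fine _ in RHS](Px' k).
Qed.

(** This expresses that S_(t n)^-1 E_x belongs to A_x' for almost all x and x': the sets of the
    dense sequence [B] have the same distances to A_x and to A_x'. *)
Lemma orbit_code_approximation : standard_borel R Y ->
  exists P : X -> Prop, {ae mu, forall x, P x} /\
  forall x x', P x -> P x' -> forall n (eps : R), (0 < eps)%R -> exists k,
    nu ([set y | E (x, S (t n) y)] `+` [set y | C k (Pi (x', y))]) < eps%:E.
Proof.
move=> /standard_borel_generated[B0 [mB0 genB0 _]].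
have [B [mB dB]] := dense_sequence mB0 genB0.
pose r (m : nat) : R := m.+1%:R^-1%R.
(* The points x for which [B i.1] is at distance less than [r i.2] from A_x. *)
pose L (i : nat * nat) :=
  \bigcup_k [set x | nu (B i.1 `+` [set y | C k (Pi (x, y))]) < (r i.2)%:E].
have mL i : measurable (L i).
  apply: bigcupT_measurable => k.
  have mV : measurable ([set w : X * Y | B i.1 w.2] `+` [set w | C k (Pi w)]).
    apply: measurable_setY; first exact: measurable_preimage measurable_snd (mB _).
    exact: measurable_preimage measurable_orbit_code (mC k).
  have := emeasurable_fun_infty_o measurableT (measurable_fun_section nu mV) (r i.2)%:E.
  by rewrite setTI.
(* Equivariance and [orbit_code_factor] at [T x] give Pi (x, y) = rho (Pi (T x, y)), so the set
   approximating [B i.1] over x is also available over [T x]. *)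
have LT i : {ae mu, forall x, L i x -> L i (T x)}.
  apply: filterS orbit_code_equivariant => x Px [k _ /= Lk].
  have [rho mrho Prho] := orbit_code_factor (T x) (phi x).
  have mrC : measurable (rho @^-1` C k) by exact: measurable_preimage.
  have {}Lk : nu (B i.1 `+` [set y | C k (rho (Pi (T x, y)))]) < (r i.2)%:E.
    apply: le_lt_trans Lk; rewrite le_eqVlt; apply/orP; left; apply/eqP.
    apply: measure_setY_ae => //; [exact: (mPiC (T x) mrC)|exact: mPiC|exact: aeW|].
    by apply: filterS2 Px Prho => y /= <- ->.
  have fL : nu (B i.1 `+` [set y | C k (rho (Pi (T x, y)))]) \is a fin_num.
    by rewrite fin_num_measure//; apply: measurable_setY => //; exact: (mPiC (T x) mrC).
  have [m mE'] := image_probability nu (mPi (T x)).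
  have mfin : m setT < +oo by rewrite probability_setT ltry.
  have [j] : exists j, m (rho @^-1` C k `+` C j) <
      (r i.2 - fine (nu (B i.1 `+` [set y | C k (rho (Pi (T x, y)))])))%:E.
    by apply: dense_C => //; rewrite subr_gt0 -lte_fin fineK.
  rewrite mE' EFinB fineK// lteBrDl// => Cj.
  exists j => //=; apply: le_lt_trans Cj.
  by apply: measure_setY_triangle => //; [exact: (mPiC (T x) mrC)|exact: mPiC].
have aeL n : {ae mu, forall x, forall i, unpickle n = Some i -> (L i x <-> mu (L i) = 1)}.
  case: (unpickle n) => [i|]; last by apply: aeW.
  by apply: filterS (ergodic_subinvariant mT muT ergT (mL i) (LT i)) => x Lx _ [<-].
exists (fun x => forall i, L i x <-> mu (L i) = 1); split.
  by apply: filterS (ae_foralln aeL) => x Lx i; apply: (Lx (pickle i)); rewrite pickleK.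
move=> x x' Px Px' n eps eps0.
have mEn : measurable [set y | E (x, S (t n) y)] by exact: (measurable_section x (mES (t n))).
(* Two errors r/2 put [x] in [L (k, m)]; passing to [x'] costs r/2 + r, which is below [eps] because
   r < eps/2. *)
have [m _ /(_ m (leqnn m)) meps] :=
  near_infty_natSinv_lt (PosNum (divr_gt0 eps0 (ltr0n R 2))).
have r0 : (0 < r m)%R by rewrite invr_gt0.
have r20 : (0 < r m / 2)%R by rewrite divr_gt0.
have [k Bk] : exists k, nu ([set y | E (x, S (t n) y)] `+` B k) < (r m / 2)%:E.
  have nuT : nu setT < +oo by rewrite probability_setT ltry.
  by apply: dB.
have [l Cl] : exists l, nu ([set y | E (x, S (t n) y)] `+` [set y | C l (Pi (x, y))]) < (r m / 2)%:E.
  have [z zE] := image_probability nu (mPi x).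
  have [l] : exists l, z (digit n `+` C l) < (r m / 2)%:E.
    have zT : z setT < +oo by rewrite probability_setT ltry.
    by apply: dense_C => //; exact: measurable_digit.
  rewrite zE => Cl; exists l; apply: le_lt_trans Cl.
  rewrite le_eqVlt; apply/orP; left; apply/eqP.
  apply: (@measure_setY_ae _ _ _ nu _ [set y | digit n (Pi (x, y))] _
    [set y | C l (Pi (x, y))]) => //.
  - exact: mPiC (measurable_digit n).
  - exact: mPiC.
  - exact: mPiC.
  - by apply: aeW => y; rewrite /= digit_Pi.
  - exact: aeW.
have Lx : L (k, m) x.
  exists l => //=; apply: le_lt_trans (measure_setY_triangle nu (mB k) mEn (mPiC x (mC l))) _.
  by rewrite (splitr (r m)) EFinD (setYC (B k)) lteD.
have [l' _ /= Cl'] : L (k, m) x' by apply/Px'/Px.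
exists l'; apply: le_lt_trans (measure_setY_triangle nu mEn (mB k) (mPiC x' (mC l'))) _.
apply: (@lt_trans _ _ ((r m / 2)%:E + (r m)%:E)); first exact: lteD.
by rewrite -EFinD lte_fin; move: meps r0; rewrite /= -/(r m); lra.
Qed.

(** Every bit over x is a function of the code over [x0] and conversely, which gives the change of
    fiber [U] and its inverse [V]. The predicate [Q] lets a further almost sure property be imposed
    on the base point. *)
Lemma orbit_code_trivialization (Q : X -> Prop) : standard_borel R Y ->
  {ae mu, forall x, Q x} ->
  exists (x0 : X) (P : X -> Prop) (U V : X * R -> R),
    [/\ Q x0, {ae mu, forall x, P x}, measurable_fun setT U, measurable_fun setT V &
      forall x, P x ->
      [/\ forall A, measurable A ->
            nu [set y | A (Pi (x, y))] = nu [set y | A (Pi (x0, y))],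
          {ae nu, forall y, U (x, Pi (x0, y)) = Pi (x, y)} &
          {ae nu, forall y, V (x, Pi (x, y)) = Pi (x0, y)}]].
Proof.
move=> sY aeQ; have [P1 [aeP1 lawP1]] := orbit_code_law.
have [P2 [aeP2 appP2]] := orbit_code_approximation sY.
have [x0 [[P1x0 P2x0] Qx0]] : exists x, (P1 x /\ P2 x) /\ Q x.
  apply: (@ae_exists _ _ _ mu); apply: filterS2 aeQ _ => [x Qx Px|]; last first.
    by apply: filterS2 aeP1 aeP2 => x; exact: conj.
  by split.
have mP : measurable_fun setT (fun w : X * Y => Pi (x0, w.2)).
  exact: measurableT_comp (mPi x0) measurable_snd.
have mW n : measurable [set w : X * Y | E (x0, S (t n) w.2)].
  exact: measurable_preimage measurable_snd (measurable_section x0 (mES (t n))).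
have [n|U mU aeU] := fiber_approximable_base4 (mu := mu) (nu := nu) mP mC
    (fun n => mES (t n)).
  by apply: filterS aeP2 => x P2x eps eps0; exact: appP2.
have [n|V mV aeV] := fiber_approximable_base4 (mu := mu) (nu := nu)
    measurable_orbit_code mC mW.
  by apply: filterS aeP2 => x P2x eps eps0; exact: appP2.
exists x0, (fun x => P1 x /\
   ({ae nu, forall y, U (x, Pi (x0, y)) = Pi (x, y)} /\
    {ae nu, forall y, V (x, Pi (x, y)) = Pi (x0, y)})), U, V; split=> //.
  by apply: filterS3 aeP1 aeU aeV => x P1x Ux Vx; split.
by move=> x [P1x [Ux Vx]]; split=> // A mA; exact: lawP1.
Qed.

End skew_product.

(** * From automorphisms of the fibers to an automorphism of the product *)

Section fiberwise_automorphism.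
Context (R : realType) dX dZ (X : measurableType dX) (Z : measurableType dZ).
Context (mu : probability X R) (zeta : probability Z R) (U V : X * Z -> Z).
Hypothesis sZ : standard_borel R Z.
Hypothesis mU : measurable_fun setT U.
Hypothesis mV : measurable_fun setT V.
Hypothesis zetaU : forall x A, measurable A -> zeta [set z | A (U (x, z))] = zeta A.
Hypothesis VU : forall x, {ae zeta, forall z, V (x, U (x, z)) = z}.
Hypothesis UV : forall x, {ae zeta, forall z, U (x, V (x, z)) = z}.

Let mUx x : measurable_fun setT (fun z => U (x, z)).
Proof. exact: measurableT_comp mU (pair1_measurable x). Qed.

Let mVx x : measurable_fun setT (fun z => V (x, z)).
Proof. exact: measurableT_comp mV (pair1_measurable x). Qed.

Lemma fiberwise_into_Aut : measurable_into_Aut zeta (fun x z => U (x, z)).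
Proof.
split=> [x|A B mA mB].
  by split=> //; [exact: zetaU|exists (fun z => V (x, z)); split].
apply: (measurable_fun_section zeta (A := U @^-1` A `&` snd @^-1` B)).
by apply: measurableI; exact: measurable_preimage.
Qed.

Lemma measurable_fun_fst_pair (W : X * Z -> Z) :
  measurable_fun setT W -> measurable_fun setT (fun w => (w.1, W w)).
Proof. by move=> mW; exact: measurable_fun_pair. Qed.

Lemma fiberwise_automorphism :
  automorphism (mu \x zeta) (fun w : X * Z => (w.1, U w)).
Proof.
have mPU := measurable_fun_fst_pair mU; have mPV := measurable_fun_fst_pair mV.
split=> //.
  move=> A mA; rewrite [LHS]product_section [RHS]product_section; apply: eq_integral => x _.
  exact: (zetaU x (measurable_section x mA)).
exists (fun w => (w.1, V w)); split => //.
- have : {ae mu \x zeta, forall w, V (w.1, U w) = w.2}.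
    apply: ae_product; last by apply: aeW => x; exact: VU.
    apply: (measurable_eq_fun sZ) => //.
    exact: measurableT_comp mV mPU.
  by apply: filterS => -[x z] /= ->.
- have : {ae mu \x zeta, forall w, U (w.1, V w) = w.2}.
    apply: ae_product; last by apply: aeW => x; exact: UV.
    apply: (measurable_eq_fun sZ) => //.
    exact: measurableT_comp mU mPV.
  by apply: filterS => -[x z] /= ->.
Qed.

End fiberwise_automorphism.

(** * Construction of the factor and of the relative isomorphism *)

Theorem corollary4 (R : realType) (dX dY : measure_display)
    (X : measurableType dX) (mu : probability X R)
    (Y : measurableType dY) (nu : probability Y R)
    (G : topologicalZmodType)
    (T : X -> X) (phi : X -> G) (S : G -> Y -> Y)
    (TphiS : X * Y -> X * Y) :
  standard_borel R X -> standard_borel R Y ->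
  hausdorff_space G -> locally_compact [set: G] -> @second_countable G ->
  automorphism mu T ->
  measurable_fun setT (phi : X -> borelType G) ->
  is_action nu S ->
  is_skew_product mu nu T (fun x => S (phi x)) TphiS ->
  ergodic mu T ->
  ~ ergodic (mu \x nu) TphiS ->
  exists A : set (set Y),
    [/\ is_factor nu S A,
        nontrivial nu A &
        exists (dZ : measure_display) (Z : measurableType dZ)
               (zeta : probability Z R) (pi : Y -> Z)
               (F1 F2 : X * Z -> X * Z),
          [/\ is_quotient nu A zeta pi,
              is_induced (mu \x nu) (fun w => (w.1, pi w.2)) TphiS F1,
              is_induced (mu \x nu) (fun w => (w.1, pi w.2))
                (fun w => (T w.1, w.2)) F2 &
              relatively_isomorphic mu zeta F1 F2]].
Proof.
move=> sX sY _ _ _ [mT muT _] _ [[autS _] SD] [mF skewF] ergT nergF.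
have mS g : measurable_fun setT (S g) by have [] := autS g.
have nuS g A : measurable A -> nu (S g @^-1` A) = nu A.
  by move=> mA; have [_ + _] := autS g; exact.
have [E [mE FE muE0 muE1]] : exists E, [/\ measurable E,
    eq_mod0 (mu \x nu) (TphiS @^-1` E) E, (mu \x nu) E <> 0 & (mu \x nu) E <> 1].
  apply: contrapT => nE; apply: nergF => E mE FE; apply: contrapT => /not_orP[? ?].
  by apply: nE; exists E.
have mFE : measurable (TphiS @^-1` E) by exact: measurable_preimage.
have invE : {ae mu, forall x, {ae nu, forall y, E (x, y) <-> E (T x, S (phi x) y)}}.
  have := ae_productW ((eq_mod0_ae _ mFE mE).1 FE).
  apply: filterS2 skewF => x Fx Ex; apply: filterS2 Fx Ex => y /=.
  by move=> -> ->.
have [t dense_t] := dense_orbit_sequence (0%R : G) sY mS nuS.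
(* Almost all sections of [E] have the same measure, which is therefore that of [E]; this makes the
   factor non-trivial. *)
have [c nuEc] : exists c, {ae mu, forall x, fine (nu [set y | E (x, y)]) = c}.
  apply: (ergodic_invariant_cst mT muT ergT).
    by apply: measurableT_comp => //; exact: measurable_fun_section.
  apply: filterS invE => x Ex; congr fine.
  rewrite -(nuS (phi x)); last exact: measurable_section.
  apply/esym/eq_measure_ae; [exact: measurable_section| |exact: Ex].
  by apply: measurable_preimage => //; exact: measurable_section.
have finE x : nu [set y | E (x, y)] \is a fin_num.
  by rewrite fin_num_measure//; exact: measurable_section.
have Ec : (mu \x nu) E = c%:E.
  transitivity (\int[mu]_x nu [set y | E (x, y)]); first exact: product_section.
  rewrite (@ge0_ae_eq_integral _ _ _ mu setT _ (cst c%:E))//.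
  - by rewrite integral_cst// [X in _ * X](@probability_setT _ _ _ mu) mule1.
  - exact: measurable_fun_section.
  - move=> x _; have [x' <-] := ae_exists nuEc.
    by rewrite lee_fin fine_ge0.
  - by apply: filterS nuEc => x <- _ /=; rewrite fineK.
have c01 : 0 < c%:E < 1.
  rewrite -Ec lt0e measure_ge0 andbT lt_neqAle probability_le1 ?andbT//.
  by apply/andP; split; apply/eqP.
have [C0 [mC0 genC0 _]] := standard_borel_generated (standard_borel_real R).
have [C [mC dC]] := dense_sequence mC0 genC0.
have [x0 [P [U [V [Ex0 aeP mU mV UV]]]]] := orbit_code_trivialization
  mT muT ergT mS nuS SD mE invE dense_t mC (dC R) sY nuEc.
set Pi := orbit_code R S E t in UV.
have mPi : measurable_fun setT Pi by exact: measurable_orbit_code.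
have equivPi := orbit_code_equivariant mS nuS SD invE t.
pose pi y := Pi (x0, y).
have mpi : measurable_fun setT pi by exact: measurableT_comp mPi (pair1_measurable x0).
have factorPi g := orbit_code_factor mu mS SD mE dense_t x0 g.
have [zeta zetaE] := image_probability nu mpi.
have [N [mN N0 subN]] := aeP.
have {}UV x : ~ N x -> [/\ forall A, measurable A -> nu [set y | A (Pi (x, y))] = zeta A,
    {ae nu, forall y, U (x, pi y) = Pi (x, y)} &
    {ae nu, forall y, V (x, Pi (x, y)) = pi y}].
  move=> nNx; have [law UP VP] := UV x (contrapT (fun nP => nNx (subN _ nP))).
  by split => // A mA; rewrite zetaE law.
(* On the null set [N] the identity is used, so that every fiber map, and not only almost every one,
   is an automorphism. *)
pose U' w := if w.1 \in N then w.2 else U w.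
pose V' w := if w.1 \in N then w.2 else V w.
have mNb : measurable_fun setT (fun w : X * R => w.1 \in N).
  apply: (measurable_fun_bool true); rewrite setTI.
  rewrite (_ : _ @^-1` _ = fst @^-1` N); first exact: measurable_preimage.
  by apply/seteqP; split=> w /=; [move/set_mem|move/mem_set].
have mU' : measurable_fun setT U' by exact: measurable_fun_ifT.
have mV' : measurable_fun setT V' by exact: measurable_fun_ifT.
have mPix x : measurable_fun setT (fun y => Pi (x, y)).
  exact: measurableT_comp mPi (pair1_measurable x).
have mU'x x : measurable_fun setT (fun z => U' (x, z)).
  exact: measurableT_comp mU' (pair1_measurable x).
have mV'x x : measurable_fun setT (fun z => V' (x, z)).
  exact: measurableT_comp mV' (pair1_measurable x).
have U'N x : N x -> forall z, U' (x, z) = z by move=> Nx z; rewrite /U' /= mem_set.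
have V'N x : N x -> forall z, V' (x, z) = z by move=> Nx z; rewrite /V' /= mem_set.
have U'C x : ~ N x -> forall z, U' (x, z) = U (x, z).
  by move=> nNx z; rewrite /U' /= memNset.
have V'C x : ~ N x -> forall z, V' (x, z) = V (x, z).
  by move=> nNx z; rewrite /V' /= memNset.
have zetaU x A : measurable A -> zeta [set z | A (U' (x, z))] = zeta A.
  move=> mA; have [/U'N Ux|nNx] := pselect (N x).
    by congr (zeta _); apply/seteqP; split=> z /=; rewrite Ux.
  have [lawx UP _] := UV x nNx.
  rewrite zetaE -lawx//; apply: eq_measure_ae.
  - exact: measurable_preimage mpi (measurable_preimage (mU'x x) mA).
  - exact: measurable_preimage.
  - by apply: filterS UP => y /=; rewrite U'C// => ->.
have VU x : {ae zeta, forall z, V' (x, U' (x, z)) = z}.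
  have [Nx|nNx] := pselect (N x); first by apply: aeW => z; rewrite U'N// V'N.
  have meq : measurable [set z | V' (x, U' (x, z)) = z].
    apply: (measurable_eq_fun (standard_borel_real R)) => //.
    exact: measurableT_comp (mV'x x) (mU'x x).
  have [_ UP VP] := UV x nNx.
  apply: (@ae_image _ _ _ _ _ nu _ _ _ mpi _ meq) => [A mA|]; first exact/esym/zetaE.
  by apply: filterS2 UP VP => y Uy Vy; rewrite U'C// V'C// Uy.
have UV' x : {ae zeta, forall z, U' (x, V' (x, z)) = z}.
  have [Nx|nNx] := pselect (N x); first by apply: aeW => z; rewrite V'N// U'N.
  have meq : measurable [set z | U' (x, V' (x, z)) = z].
    apply: (measurable_eq_fun (standard_borel_real R)) => //.
    exact: measurableT_comp (mU'x x) (mV'x x).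
  have [lawx UP VP] := UV x nNx.
  (* The claim is pulled back along [Pi (x, _)], whose law is also [zeta], because [V] is known on
     codes over x. *)
  apply: (@ae_image _ _ _ _ _ nu _ _ _ (mPix x) _ meq) => [A mA|]; first exact: lawx.
  by apply: filterS2 UP VP => y Uy Vy; rewrite V'C// U'C// Vy.
have mTU : measurable_fun setT (fun w : X * R => (T w.1, U' w)).
  by apply: measurable_fun_pair => //; exact: measurableT_comp.
(* With R_x = [U' (x, _)], the induced map acts on fibers by R_(Tx)^-1 R_x. *)
pose F1 (w : X * R) := (T w.1, V' (T w.1, U' w)).
pose F2 (w : X * R) := (T w.1, w.2).
have mF1 : measurable_fun setT F1.
  apply: measurable_fun_pair; first exact: measurableT_comp.
  exact: measurableT_comp mV' mTU.
have mF2 : measurable_fun setT F2.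
  by apply: measurable_fun_pair => //; exact: measurableT_comp.
have mPhi := measurable_fun_fst_pair mU'.
(* The factor is generated by [pi], that is, by the sets S_(t n)^-1 E_x0. *)
exists (preimage_set_system setT pi measurable); split.
- split.
  + by apply: sigma_algebra_preimage; exact: sigma_algebra_measurable.
  + by move=> _ [B mB <-]; rewrite setTI; exact: measurable_preimage.
  + move=> g _ [B mB <-]; have [rho mrho rhoP] := factorPi g.
    exists (pi @^-1` (rho @^-1` B)).
      by exists (rho @^-1` B); rewrite ?setTI//; exact: measurable_preimage.
    rewrite setTI; apply/eq_mod0_ae.
    * by do 2!apply: measurable_preimage => //.
    * by apply: measurable_preimage mpi _; exact: measurable_preimage.
    * by apply: filterS rhoP => y /= ->.
- exists (pi @^-1` digit 0).
    by exists (digit 0); [exact: measurable_digit|rewrite setTI].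
  have -> : pi @^-1` digit 0 = S (t 0%N) @^-1` [set y | E (x0, y)].
    by apply/seteqP; split=> y; rewrite /pi /= base4_digit asboolE.
  suff e : nu (S (t 0%N) @^-1` [set y | E (x0, y)]) = c%:E by move: c01; rewrite -e.
  by rewrite nuS; [rewrite -(fineK (finE x0)) Ex0|exact: measurable_section].
- exists _, R, zeta, pi, F1, F2; split.
  + split; first exact: standard_borel_real.
    split => //.
    * by move=> B _; exact: zetaE.
    * by move=> _ [B mB <-]; exists B; rewrite // setTI /eq_mod0 setYK measure0.
    * move=> B mB; exists (pi @^-1` B); last by rewrite /eq_mod0 setYK measure0.
      by exists B; rewrite ?setTI.
  + split=> //.
    have mp : measurable_fun setT (fun w : X * Y => (w.1, pi w.2)).
      by apply: measurable_fun_pair => //; exact: measurableT_comp mpi measurable_snd.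
    have mFp := measurableT_comp mF1 mp; have mpF := measurableT_comp mp mF.
    (* The coordinates are compared separately: the equality sets are measurable because [X] and the
       real line are standard. *)
    have eq1 : {ae mu \x nu, forall w : X * Y, (F1 (w.1, pi w.2)).1 = (TphiS w).1}.
      apply: ae_product.
        apply: (measurable_eq_fun sX); first exact: measurableT_comp measurable_fst mFp.
        exact: measurableT_comp measurable_fst mF.
      by apply: filterS skewF => x; apply: filterS => y /= ->.
    have eq2 : {ae mu \x nu, forall w : X * Y, (F1 (w.1, pi w.2)).2 = pi (TphiS w).2}.
      apply: ae_product.
        apply: (measurable_eq_fun (standard_borel_real R)).
          exact: measurableT_comp measurable_snd mFp.
        exact: measurableT_comp measurable_snd mpF.
      (* Both [x] and [T x] must avoid [N]: U takes [pi y] to Pi (x, y) = Pi (T x, S_(phi x) y), and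
         V over [T x] takes this to pi (S_(phi x) y). *)
      have aeN : {ae mu, forall x, ~ N x} by exists N; split => // x /= /contrapT.
      have aeNT := ae_preimage mT muT aeN.
      have aeN2 : {ae mu, forall x, ~ N x /\ ~ N (T x)}.
        by apply: filterS2 aeN aeNT => x; exact: conj.
      apply: filterS3 skewF equivPi aeN2 => x Fx eqx [nNx nNTx].
      have [_ Ux _] := UV x nNx; have [_ _ VTx] := UV (T x) nNTx.
      have VTSx := ae_preimage (mS (phi x)) (nuS (phi x)) VTx.
      have FUx : {ae nu, forall y, TphiS (x, y) = (T x, S (phi x) y) /\ U (x, pi y) = Pi (x, y)}.
        by apply: filterS2 Fx Ux => y; exact: conj.
      apply: filterS3 FUx eqx VTSx => y [Fy Uy] eqy Vy.
      by rewrite Fy /F1 /= U'C// V'C// Uy -[Pi _]eqy.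
    by apply: filterS2 eq1 eq2 => -[x y] /= e1 e2; rewrite /F1 /= in e1 e2 *; rewrite e2 e1.
  + by split=> //; exact: aeW.
  + exists (fun x z => U' (x, z)), (fun w => (w.1, U' w)); split.
    * exact: (fiberwise_into_Aut mU' mV' zetaU VU UV').
    * by split=> //; apply: aeW => x; apply: aeW.
    * exact: (fiberwise_automorphism mu (standard_borel_real R) mU' mV' zetaU VU UV').
    (* In the conjugation, R_(Tx) R_(Tx)^-1 cancels and leaves R_x, the second coordinate of [F2]
       after the isomorphism. *)
    * have : {ae mu \x zeta, forall w, U' (T w.1, V' (T w.1, U' w)) = U' w}.
        apply: ae_product.
          apply: (measurable_eq_fun (standard_borel_real R)) => //.
          exact: measurableT_comp mU' mF1.
        apply: aeW => x; exact: ae_preimage (mU'x x) (zetaU x) (UV' (T x)).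
      by apply: filterS => -[x z] /= e; rewrite /F1 /F2 /= e.
Qed.
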